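(* Let $\mathcal{A}=((V_i)_{1\le i\le n},E)$ be an $n$-player arena (with a possibly infinite vertex set $V$), let $T_1,\dots,T_n\subseteq V$ and let $\mathcal{G}=(\mathcal{A},(\mathsf{Reach}(T_i))_{1\le i\le n})$ be the associated reachability game. Let $\sigma'$ be a Nash equilibrium from a vertex $v_0$ in $\mathcal{G}$, with outcome $\pi'=\mathsf{Out}(\sigma',v_0)$. Then there exists a finite-memory Nash equilibrium $\sigma$ from $v_0$ in $\mathcal{G}$ such that $\mathsf{SatPl}(\mathsf{Out}(\sigma,v_0))=\mathsf{SatPl}(\pi')$ and each strategy of $\sigma$ has a memory size of at most $$\max\{1,\,n-|\mathsf{SatPl}(\pi')|\}\cdot\max\{1,\,|\mathsf{VisPos}(\pi')\setminus\{0\}|\}\ \le\ n^2 .$$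
   Context: Arenas. An $n$-player arena ($n\ge 1$) is $\mathcal{A}=((V_i)_{1\le i\le n},E)$ where $V$ is a (possibly infinite) set of vertices, $(V_i)_{1\le i\le n}$ is a partition of $V$ (parts may be empty; $V_i$ is the set of vertices controlled by player $P_i$), $E\subseteq V\times V$, and every vertex has at least one $E$-successor. A play is an infinite sequence $v_0v_1\ldots$ with $(v_\ell,v_{\ell+1})\in E$ for all $\ell\in\mathbb{N}$; a history is a finite non-empty prefix of a play. Strategies. A strategy of $P_i$ is a function $\sigma_i$ mapping each history $h$ ending in $V_i$ to an $E$-successor of the last vertex of $h$. A strategy profile is a tuple $\sigma=(\sigma_i)_{1\le i\le n}$ with one strategy per player. A play $v_0v_1\ldots$ is consistent with $\sigma_i$ if $v_\ell\in V_i$ implies $v_{\ell+1}=\sigma_i(v_0\ldots v_\ell)$ for all $\ell$. $\mathsf{Out}(\sigma,v_0)$ is the unique play from $v_0$ consistent with all strategies of $\sigma$. Finite memory. A Mealy machine of $P_i$ is $(M,m_{\mathsf{init}},\mathsf{up},\mathsf{nxt}_i)$ with $M$ a finite set, $m_{\mathsf{init}}\in M$, $\mathsf{up}\colon M\times V\to M$ and $\mathsf{nxt}_i\colon M\times V_i\to V$. Let $\widehat{\mathsf{up}}(\varepsilon)=m_{\mathsf{init}}$ and $\widehat{\mathsf{up}}(wv)=\mathsf{up}(\widehat{\mathsf{up}}(w),v)$ for $w\in V^*$, $v\in V$. The machine induces the strategy $\sigma_i(h'v)=\mathsf{nxt}_i(\widehat{\mathsf{up}}(h'),v)$ for every history $h'v$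 ending in $v\in V_i$ (with $h'\in V^*$ possibly empty). A strategy is finite-memory if it is induced by a Mealy machine, and has memory size at most $b$ if it is induced by some Mealy machine with $|M|\le b$. A strategy profile is finite-memory if all its strategies are. Objectives and equilibria. $\mathsf{Reach}(T)$ is the set of plays in which some vertex of $T$ occurs; the objective of $P_i$ in $\mathcal{G}$ is $\mathsf{Reach}(T_i)$. For a play $\pi=v_0v_1\ldots$, $\mathsf{SatPl}(\pi)=\{i\mid \pi\in\mathsf{Reach}(T_i)\}$ and $\mathsf{VisPos}(\pi)=\{\min\{\ell\in\mathbb{N}\mid v_\ell\in T_i\}\mid i\in\mathsf{SatPl}(\pi)\}$. A strategy profile $\sigma$ is a Nash equilibrium from $v_0$ if no player whose objective is not satisfied by $\mathsf{Out}(\sigma,v_0)$ has a strategy such that, when this player alone replaces their strategy in $\sigma$ by it, the outcome from $v_0$ satisfies their objective. *)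

(* Defs.v *)
From mathcomp Require Import all_boot finmap.
From mathcomp Require Import boolp classical_sets cardinality.

Set Implicit Arguments.
Unset Strict Implicit.
Unset Printing Implicit Defensive.

Local Open Scope classical_set_scope.

(* [trivIset] and the covering condition say that the [ctrl i] partition [V],
   with possibly empty parts. *)
Record arena (n : nat) (V : Type) := Arena {
  ctrl : 'I_n -> set V;
  edge : V -> V -> Prop;
  ctrl_cover : \bigcup_i ctrl i = setT;
  ctrl_triv : trivIset setT ctrl;
  edge_total : forall v, exists w, edge v w }.

Definition is_play n V (A : arena n V) (pi : nat -> V) : Prop :=
  forall l, edge A (pi l) (pi l.+1).

Definition is_history n V (A : arena n V) (h : seq V) : Prop :=
  exists pi k, is_play A pi /\ h = mkseq pi k.+1.

(* The value of a strategy on sequences that are not histories ending in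
   [ctrl A i] is unconstrained and never used. *)
Record strategy n V (A : arena n V) (i : 'I_n) := Strategy {
  strat :> seq V -> V;
  stratP : forall (h : seq V) (v : V), is_history A (rcons h v) ->
    ctrl A i v -> edge A v (strat (rcons h v)) }.

Definition profile n V (A : arena n V) : Type := forall i, strategy A i.

Definition consistent n V (A : arena n V) (i : 'I_n) (s : strategy A i)
    (pi : nat -> V) : Prop :=
  forall l, ctrl A i (pi l) -> pi l.+1 = s (mkseq pi l.+1).

Definition is_outcome n V (A : arena n V) (s : profile A) (v0 : V)
    (pi : nat -> V) : Prop :=
  [/\ is_play A pi, pi 0 = v0 & forall i, consistent (s i) pi].

Section OutcomeExistence.
Variables (n : nat) (V : Type) (A : arena n V).

Lemma ctrl_ex v : exists i, ctrl A i v.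
Proof.
have : (\bigcup_i ctrl A i) v by rewrite ctrl_cover.
by case=> i _ Av; exists i.
Qed.

Lemma is_history_mkseq (f : nat -> V) k :
  (forall l, l < k -> edge A (f l) (f l.+1)) -> is_history A (mkseq f k.+1).
Proof.
move=> fE; have [succ succP] := choice (edge_total A).
exists (fun l => if l <= k then f l else iter (l - k) succ (f k)), k; split.
  move=> l /=; case: (ltngtP l k) => [lk|kl|->].
  - exact: fE.
  - by rewrite (subSn (ltnW kl)); exact: succP.
  - by rewrite subSnn; exact: succP.
apply: (eq_from_nth (x0 := f 0)); first by rewrite !size_mkseq.
move=> l; rewrite size_mkseq => lk.
by rewrite !(nth_mkseq (f 0)) // -[l <= k]ltnS lk.
Qed.

Lemma outcome_unique (s : profile A) v0 pi pi' :
  is_outcome s v0 pi -> is_outcome s v0 pi' -> pi = pi'.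
Proof.
move=> [_ p0 pC] [_ p0' pC'].
suff H k : forall l, l <= k -> pi l = pi' l by apply: funext => k; exact: (H k).
elim: k => [|k IH] l; first by rewrite leqn0 => /eqP ->; rewrite p0 p0'.
rewrite leq_eqVlt => /predU1P[->|]; last by rewrite ltnS; exact: IH.
have [i iv] := ctrl_ex (pi k).
rewrite (pC _ _ iv) (pC' i) -?IH //; congr (s i _).
apply: (eq_from_nth (x0 := v0)); first by rewrite !size_mkseq.
move=> l'; rewrite size_mkseq => lk.
by rewrite !(nth_mkseq v0) // IH.
Qed.

Lemma outcome_ex (s : profile A) v0 : exists pi, is_outcome s v0 pi.
Proof.
have [owner ownerP] := choice ctrl_ex.
pose next h := s (owner (last v0 h)) h.
pose hist k := iter k (fun h => rcons h (next h)) [:: v0].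
pose pi k := last v0 (hist k).
have piS k : pi k.+1 = next (hist k) by rewrite /pi /= last_rcons.
have histE k : hist k = mkseq pi k.+1.
  elim: k => // k IH.
  by rewrite mkseqS -IH piS.
have piE k : edge A (pi k) (pi k.+1).
  elim/ltn_ind: k => k IH; have hk := is_history_mkseq IH.
  have E : mkseq pi k.+1 = rcons (mkseq pi k) (pi k).
    exact: mkseqS.
  rewrite piS /next histE E; apply: stratP; first by rewrite -E.
  by rewrite last_rcons.
exists pi; split=> // i l iv; rewrite piS -histE /next -/(pi l).
suff -> : owner (pi l) = i by [].
by apply: (ctrl_triv (a := A)) => //; exists (pi l); split.
Qed.

End OutcomeExistence.

Definition outcome n V (A : arena n V) (s : profile A) (v0 : V) : nat -> V :=
  sval (cid (outcome_ex s v0)).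

Lemma outcomeP n V (A : arena n V) (s : profile A) v0 :
  is_outcome s v0 (outcome s v0).
Proof. by rewrite /outcome; case: cid. Qed.

(* The values of [nxt] outside the vertices of the player running the machine
   are never used. *)
Record mealy (V : Type) := Mealy {
  mem_state : finType;
  mem_init : mem_state;
  mem_up : mem_state -> V -> mem_state;
  mem_nxt : mem_state -> V -> V }.

Definition mem_up_hat V (M : mealy V) (w : seq V) : mem_state M :=
  foldl (@mem_up V M) (mem_init M) w.

Definition induces n V (A : arena n V) (i : 'I_n) (M : mealy V)
    (s : strategy A i) : Prop :=
  forall (h : seq V) (v : V), is_history A (rcons h v) -> ctrl A i v ->
    s (rcons h v) = mem_nxt (mem_up_hat M h) v.

Definition finite_memory n V (A : arena n V) (i : 'I_n) (s : strategy A i) :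
    Prop :=
  exists M : mealy V, induces M s.

Definition memory_size_at_most n V (A : arena n V) (i : 'I_n)
    (s : strategy A i) (b : nat) : Prop :=
  exists M : mealy V, induces M s /\ #|mem_state M| <= b.

Definition finite_memory_profile n V (A : arena n V) (s : profile A) : Prop :=
  forall i, finite_memory (s i).

Definition reach V (T : set V) : set (nat -> V) :=
  [set pi | exists l, T (pi l)].

Definition SatPl n V (T : 'I_n -> set V) (pi : nat -> V) : {set 'I_n} :=
  [set i | `[< reach (T i) pi >]]%SET.

Definition is_min (S : set nat) (l : nat) : Prop :=
  S l /\ forall k, S k -> l <= k.

Definition VisPos n V (T : 'I_n -> set V) (pi : nat -> V) : set nat :=
  [set m | exists i, i \in SatPl T pi /\ is_min [set l | T i (pi l)] m].

(* Ensures that [fset_set], which is only meaningful on finite sets, gives the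
   actual cardinality of [VisPos T pi] and of its subsets. *)
Lemma finite_VisPos n V (T : 'I_n -> set V) pi : finite_set (VisPos T pi).
Proof.
have /choice[f fP] (i : 'I_n) : exists m,
    forall k, is_min [set l | T i (pi l)] k -> k = m.
  have [[m [Tm mP]]|H] := pselect (exists m, is_min [set l | T i (pi l)] m).
    exists m => k [Tk kP]; apply/eqP; rewrite eqn_leq.
    by rewrite kP // mP.
  by exists 0 => k Hk; case: H; exists k.
apply: (@sub_finite_set _ _ (f @` setT)).
  by move=> m [i [_ im]]; exists i => //; rewrite (fP i m im).
exact/finite_image/finite_finset.
Qed.

(* [dfwith s t] is the profile [s] in which the strategy of player [i] is
   replaced by [t : strategy A i]. *)
Definition nash n V (A : arena n V) (T : 'I_n -> set V) (v0 : V)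
    (s : profile A) : Prop :=
  forall i, i \notin SatPl T (outcome s v0) ->
    ~ exists t : strategy A i, reach (T i) (outcome (dfwith s t) v0).

Definition memory_bound n V (T : 'I_n -> set V) (pi : nat -> V) : nat :=
  maxn 1 (n - #|SatPl T pi|) * maxn 1 #|` fset_set (VisPos T pi `\ 0) |.

(* Main.v *)
(* Let [p] be the outcome of the given equilibrium [s'] and, for a player [i],
   let [X_i] be the set of vertices that [i] can reach by deviating alone from
   [s'].  A move of [i] never leaves [X_i], the other players can always stay in
   [X_i], and if [i] does not win along [p] then [X_i] avoids the target of [i]:
   this gives a memoryless punishment of [i], without any determinacy argument.
   All vertices of [p] lie in every [X_i].  The new profile visits the first
   positions of [p] in the targets one after the other, each time moving without
   memory inside the vertices of [p]; outside these vertices it punishes the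
   losing player who was the last one to move from a vertex of [p]. *)
Require Import Defs.
From mathcomp Require Import all_boot finmap.
From mathcomp Require Import boolp classical_sets cardinality.

Set Implicit Arguments.
Unset Strict Implicit.
Unset Printing Implicit Defensive.

(** * Memoryless shortcuts along a sequence *)

(** When [pi a] does not occur before [m], the second clause is vacuous and [b] is [a] itself;
    otherwise [b] is the largest occurrence before [m]. *)
Lemma last_occurrence (V : Type) (pi : nat -> V) (m a : nat) :
  exists b, pi b = pi a /\ forall a', a' < m -> pi a' = pi a -> a' <= b < m.
Proof.
have [[a0 [am ae]]|none] := pselect (exists a0, a0 < m /\ pi a0 = pi a).
  have exP : exists b, `[< b < m /\ pi b = pi a >] by exists a0; apply/asboolP.
  have ubP b : `[< b < m /\ pi b = pi a >] -> b <= m.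
    by move=> /asboolP[/ltnW].
  case: (ex_maxnP exP ubP) => b /asboolP[bm be] bmax.
  by exists b; split=> // a' am' ae'; rewrite bm bmax//; apply/asboolP.
by exists a; split=> // a' am' ae'; case: none; exists a'.
Qed.

(* Leaving every vertex the way it was left the last time before [m] makes the
   position in [pi] strictly increase, so that [m] is reached without memory. *)
Lemma memoryless_shortcut (V : Type) (pi : nat -> V) (m : nat) :
  exists f : V -> V,
    (forall a, exists b, pi b = pi a /\ f (pi a) = pi b.+1) /\
    (forall a, a < m -> exists d, iter d.+1 f (pi a) = pi m).
Proof.
have : forall v, exists b, forall a, v = pi a -> pi b = v /\
    forall a', a' < m -> pi a' = v -> a' <= b < m.
  move=> v; have [[a ->]|none] := pselect (exists a, v = pi a).
    by have [b bP] := last_occurrence pi m a; exists b.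
  by exists 0 => a va; case: none; exists a.
move=> /choice[b bP]; exists (fun v => pi (b v).+1); split.
  by move=> a; exists (b (pi a)); have [] := bP _ a erefl.
move=> a; have [k] := ubnP (m - a); elim: k a => // k IH a ka am.
have [_ /(_ a am erefl)/andP[ab]] := bP _ a erefl.
rewrite leq_eqVlt => /predU1P[bm|bm]; first by exists 0; rewrite /= bm.
have [|d dE] := IH (b (pi a)).+1 _ bm; last by exists d.+1; rewrite iterSr.
rewrite ltnS in ka; apply: leq_trans ka.
by rewrite ltn_sub2l.
Qed.

Lemma eq_mkseq_lt (V : Type) (f g : nat -> V) k :
  (forall l, l < k -> f l = g l) -> mkseq f k = mkseq g k.
Proof.
by move=> fg; apply/eq_in_map => l; rewrite mem_iota => /fg.
Qed.

Lemma owner_unique (n : nat) (V : Type) (A : arena n V) (i j : 'I_n) v :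
  ctrl A i v -> ctrl A j v -> i = j.
Proof. by move=> iv jv; apply: (ctrl_triv (a := A)) => //; exists v. Qed.

(** * Vertices reachable by a single deviating player *)

(** The constraints stop at [k]: later values of [rho] are arbitrary, so a finite path need not be
    extended to a play. *)
Definition deviation_path (n : nat) (V : Type) (A : arena n V) (s : profile A)
    (v0 : V) (i : 'I_n) (rho : nat -> V) (k : nat) : Prop :=
  [/\ rho 0 = v0,
      forall l, l < k -> edge A (rho l) (rho l.+1) &
      forall l, l < k -> forall j, j != i -> ctrl A j (rho l) ->
        rho l.+1 = s j (mkseq rho l.+1)].

Definition deviation_region (n : nat) (V : Type) (A : arena n V)
    (s : profile A) (v0 : V) (i : 'I_n) (v : V) : Prop :=
  exists rho k, deviation_path s v0 i rho k /\ rho k = v.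

Section DeviationRegion.
Variables (n : nat) (V : Type) (A : arena n V) (s : profile A) (v0 : V).
Variable (i : 'I_n).

Local Notation X := (deviation_region s v0 i).

Lemma deviation_region_outcome k : X (outcome s v0 k).
Proof.
have [pE p0 pC] := outcomeP s v0.
by exists (outcome s v0), k; split=> //; split=> // l _ j _; exact: pC.
Qed.

Lemma deviation_region_step rho k w : deviation_path s v0 i rho k ->
  edge A (rho k) w ->
  (forall j, j != i -> ctrl A j (rho k) -> w = s j (mkseq rho k.+1)) -> X w.
Proof.
move=> [r0 rE rC] Ew wC.
pose rho' l := if l <= k then rho l else w.
have rho'E l : l <= k -> rho' l = rho l by rewrite /rho' => ->.
have rho'S : rho' k.+1 = w by rewrite /rho' ltnn.
have mkE l : l <= k -> mkseq rho' l.+1 = mkseq rho l.+1.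
  by move=> lk; apply: eq_mkseq_lt => l' l'l; apply: rho'E; apply: leq_trans lk.
exists rho', k.+1; split=> //; split=> [|l|l].
- by rewrite rho'E.
- rewrite ltnS leq_eqVlt => /predU1P[->|lk]; first by rewrite rho'S rho'E.
  by rewrite !rho'E ?(ltnW lk)//; apply: rE.
- rewrite ltnS leq_eqVlt => /predU1P[->|lk] j ji.
    by rewrite rho'S rho'E // mkE //; apply: wC.
  by rewrite mkE ?(ltnW lk)// !rho'E ?(ltnW lk)//; apply: rC.
Qed.

Lemma deviation_region_own v w : X v -> ctrl A i v -> edge A v w -> X w.
Proof.
move=> [rho [k [dev <-]]] iv /(deviation_region_step dev); apply=> j ji jv.
by rewrite (owner_unique iv jv) eqxx in ji.
Qed.

(** Any one path witnessing [X v] gives a history at which the owner of [v] can be asked for a move;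
    forgetting that history makes the answer memoryless. The edge is unconditional so that the
    choice is legal at every vertex. *)
Lemma deviation_region_other v :
  exists w, edge A v w /\ (X v -> ~ ctrl A i v -> X w).
Proof.
have [[Xv niv]|nX] := pselect (X v /\ ~ ctrl A i v); last first.
  have [w vw] := edge_total A v; exists w; split=> // Xv niv.
  by case: nX.
have [rho [k [dev rv]]] := Xv; have [j jv] := ctrl_ex A v.
have vw : edge A (rho k) (s j (mkseq rho k.+1)).
  rewrite mkseqS; apply: stratP; last by rewrite rv.
  by rewrite -mkseqS; apply: is_history_mkseq; case: dev.
exists (s j (mkseq rho k.+1)); split=> [|_ _]; first by rewrite -rv.
apply: deviation_region_step dev vw _ => j' _; rewrite rv => jv'.
by rewrite (owner_unique jv' jv).
Qed.

Lemma deviation_path_strategy rho k : deviation_path s v0 i rho k ->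
  exists t : strategy A i, outcome (dfwith s t) v0 k = rho k.
Proof.
move=> [r0 rE rC].
(* The deviation replays [rho] on its prefixes, compared through [{classic V}], and falls back on
   [s i] elsewhere, so that it is legal on every history. *)
pose on_path h := (h == mkseq rho (size h) :> seq {classic V}) && (size h <= k).
pose f h := if on_path h then rho (size h) else s i h.
have fP h v : is_history A (rcons h v) -> ctrl A i v ->
    edge A v (f (rcons h v)).
  move=> hist iv; rewrite /f; case: ifP => [|_]; last exact: stratP.
  rewrite /on_path size_rcons mkseqS => /andP[/eqP/rcons_inj[_ ->]].
  exact: rE.
pose t : strategy A i := Strategy fP.
exists t; have [_ p0 pC] := outcomeP (dfwith s t) v0.
suff H l : l <= k -> outcome (dfwith s t) v0 l = rho l by exact: H.
elim/ltn_ind: l => -[_ _|l IH lk]; first by rewrite p0.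
set p := outcome _ _ in p0 pC IH *.
have mkE : mkseq p l.+1 = mkseq rho l.+1.
  by apply: eq_mkseq_lt => l' l'l; apply: (IH _ l'l);
    exact: leq_trans (ltnW l'l) lk.
have pl : p l = rho l by apply: IH; [exact: ltnSn | exact: ltnW].
have [j jv] := ctrl_ex A (p l); rewrite (pC _ _ jv) mkE.
have [ij|ij] := eqVneq i j; last first.
  by rewrite dfwith_out // -rC // -?pl // eq_sym.
case: j / ij jv => _; rewrite dfwith_in /= /f /on_path size_mkseq.
by rewrite eqxx lk.
Qed.

Lemma deviation_region_safe (T : 'I_n -> set V) : nash T v0 s ->
  i \notin SatPl T (outcome s v0) -> forall v, X v -> ~ T i v.
Proof.
move=> sN iS v [rho [k [dev <-]]] Tv; apply: (sN i iS).
have [t tE] := deviation_path_strategy dev.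
by exists t, k; rewrite tE.
Qed.

End DeviationRegion.


(** * Strategies induced by Mealy machines *)

Section MealyStrategy.
Variables (n : nat) (V : Type) (A : arena n V) (i : 'I_n) (M : mealy V).
Hypothesis nxtE : forall m v, edge A v (mem_nxt (m : mem_state M) v).

Lemma mem_up_hat_rcons h v :
  mem_up_hat M (rcons h v) = mem_up (mem_up_hat M h) v.
Proof. by rewrite /mem_up_hat foldl_rcons. Qed.

Lemma mealy_strategy_ex (x0 : V) : exists s : strategy A i, forall h v,
  s (rcons h v) = mem_nxt (mem_up_hat M h) v.
Proof.
pose f h := mem_nxt (mem_up_hat M (take (size h).-1 h)) (last x0 h).
have fE h v : f (rcons h v) = mem_nxt (mem_up_hat M h) v.
  by rewrite /f size_rcons last_rcons -cats1 take_size_cat.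
have fP h v : is_history A (rcons h v) -> ctrl A i v ->
    edge A v (f (rcons h v)) by rewrite fE.
by exists (Strategy fP).
Qed.

End MealyStrategy.

(** * Visiting the targets in order *)

(** The index stays at the last target once it gets there, so [K] targets cost only [K] memory
    values. *)
Definition advance (V : Type) (K : nat) (tgt : nat -> V) (j : nat) (v : V) :
    nat :=
  if `[< v = tgt j >] && (j.+1 < K) then j.+1 else j.

Lemma advance_lt (V : Type) (K : nat) (tgt : nat -> V) (j : 'I_K) (v : V) :
  advance K tgt j v < K.
Proof. by rewrite /advance; case: ifP => [/andP[]|]. Qed.

Section Targets.
Variables (V : Type) (K : nat) (p : nat -> V) (m : nat -> nat).
Variables (f : nat -> V -> V) (x : nat -> V) (J : nat -> nat).
Hypothesis m0 : 0 < m 0.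
Hypothesis mS : forall j, j.+1 < K -> m j < m j.+1.
Hypothesis fP : forall j a,
  a < m j -> exists d, iter d.+1 (f j) (p a) = p (m j).
Hypothesis x0 : x 0 = p 0.
Hypothesis J0 : J 0 = 0.
Hypothesis JS : forall l, J l.+1 = advance K (p \o m) (J l) (x l).
Hypothesis xS : forall l, x l.+1 = f (J l.+1) (x l).

(** The index cannot change before target [j] is met, and until then [x] follows the fixed map
    [f j]; hence an induction on the number of steps left. *)
Lemma target_reached_from d l j : J l = j -> iter d (f j) (x l) = p (m j) ->
  exists l', J l' = j /\ x l' = p (m j).
Proof.
elim: d l => [|d IH] l Jl dE; first by exists l.
have [xl|xl] := pselect (x l = p (m j)); first by exists l.
have JSl : J l.+1 = j.
  by rewrite JS /advance Jl; case: ifP => // /andP[/asboolP].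
by apply: (IH l.+1) => //; rewrite xS JSl -iterSr.
Qed.

Lemma target_reached j : j < K -> exists l, J l = j /\ x l = p (m j).
Proof.
elim: j => [|j IH] jK.
  by have [d dE] := fP m0; apply: (@target_reached_from d.+1 0); rewrite ?x0.
have [l [Jl xl]] := IH (ltnW jK).
have JSl : J l.+1 = j.+1.
  by rewrite JS /advance Jl xl jK andbT; case: asboolP.
(* The index is updated before moving, so the move out of target [j] already follows [f j.+1]. *)
have [d] := fP (mS jK); rewrite iterSr => dE.
by apply: (@target_reached_from d l.+1); rewrite ?xS ?JSl ?xl.
Qed.

End Targets.

(** * The machine and its equilibrium *)

Section PunishingMachine.
Variables (n : nat) (V : Type) (U : {set 'I_n}) (K : nat).
Variables (u0 : {i | i \in U}) (j0 : 'I_K) (own : V -> 'I_n) (R : set V).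
Variables (tgt : nat -> V) (f : nat -> V -> V) (c : 'I_n -> V -> V).

(* The first component of a state is the player of [U] to punish when the play
   is outside [R], namely the last one to have moved from a vertex of [R]
   (players outside [U] are not recorded); the second one is the index of the
   current target. *)
Definition punishing_machine : mealy V := {|
  mem_state := ({i | i \in U} * 'I_K)%type : finType;
  mem_init := (u0, j0);
  mem_up := fun m v => (if `[< R v >] then insubd m.1 (own v) else m.1,
                        Ordinal (advance_lt tgt m.2 v));
  mem_nxt := fun m v => if `[< R v >] then f (advance K tgt m.2 v) v
                        else c (val m.1) v |}.

Lemma card_punishing_machine : #|mem_state punishing_machine| = #|U| * K.
Proof. by rewrite card_prod card_sig card_ord. Qed.

End PunishingMachine.

Lemma mem_SatPl (n : nat) (V : Type) (T : 'I_n -> set V) (pi : nat -> V) i :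
  reflect (exists l, T i (pi l)) (i \in SatPl T pi).
Proof. by rewrite inE; exact: asboolP. Qed.

(** [U] may be larger than the set of losing players, since it must be nonempty even if everyone
    wins. Position 0 needs no target: every play considered starts there. *)
Lemma finite_memory_nash (n : nat) (V : Type) (A : arena n V)
    (T : 'I_n -> set V) (v0 : V) (s' : profile A) (U : {set 'I_n})
    (u0 : {i | i \in U}) (K : nat) (m : nat -> nat) :
  nash T v0 s' ->
  (forall i, i \notin SatPl T (outcome s' v0) -> i \in U) ->
  0 < K -> 0 < m 0 -> (forall j, j.+1 < K -> m j < m j.+1) ->
  (forall i, i \in SatPl T (outcome s' v0) -> exists a,
    T i (outcome s' v0 a) /\ (a = 0 \/ exists2 j, j < K & a = m j)) ->
  exists s : profile A,
    [/\ forall i, exists M, induces M (s i) /\ #|mem_state M| = #|U| * K,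
        nash T v0 s & SatPl T (outcome s v0) = SatPl T (outcome s' v0)].
Proof.
move=> s'N UP K0 m0 mS mP; set p := outcome s' v0 in UP mP *.
have [p_edge p0 _] := outcomeP s' v0; rewrite -/p in p_edge p0.
have /choice[own ownP] := ctrl_ex A.
have ownE i v : ctrl A i v -> own v = i by exact: owner_unique.
pose X := deviation_region s' v0.
have /choice[f fP] j := memoryless_shortcut p (m j).
have f_range j a : exists b, f j (p a) = p b.
  by have [b [_ ->]] := (fP j).1 a; exists b.+1.
have f_edge j a : edge A (p a) (f j (p a)).
  by have [b [<- ->]] := (fP j).1 a.
have /choice[c cP] : forall i, exists ci : V -> V, forall v,
    edge A v (ci v) /\ (X i v -> ~ ctrl A i v -> X i (ci v)).
  by move=> i; have /choice[ci] := deviation_region_other s' v0 i; exists ci.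
pose R : set V := [set v | exists a, v = p a]%classic.
have RX i v : R v -> X i v.
  by move=> [a ->]; exact: deviation_region_outcome.
pose M := punishing_machine u0 (Ordinal K0) own R (p \o m) f c.
have M_edge st v : edge A v (mem_nxt (st : mem_state M) v).
  by rewrite /=; case: asboolP => [[a ->]|_]; [exact: f_edge|exact: (cP _ _).1].
pose s : profile A := fun i => sval (cid (mealy_strategy_ex i M_edge v0)).
have sE i h v : s i (rcons h v) = mem_nxt (mem_up_hat M h) v.
  exact: (svalP (cid (mealy_strategy_ex i M_edge v0))).
have s_ind i : induces M (s i) by move=> h v _ _; exact: sE.
pose mem (x : nat -> V) l := mem_up_hat M (mkseq x l).
have memS x l : mem x l.+1 = mem_up (mem x l) (x l).
  by rewrite /mem mkseqS mem_up_hat_rcons.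
set q := outcome s v0; have [_ q0 qC] := outcomeP s v0; rewrite -/q in q0 qC.
have qS l : q l.+1 = mem_nxt (mem q l) (q l).
  by rewrite (qC _ _ (ownP (q l))) mkseqS sE.
have qR l : R (q l).
  elim: l => [|l IH]; first by exists 0; rewrite p0.
  rewrite qS /= asboolT //; case: IH => a ->.
  by have [b ->] := f_range (advance K (p \o m) (mem q l).2 (p a)) a; exists b.
have q_sat : SatPl T q = SatPl T p.
  (* No new winner arises because [q] stays on the vertices of [p]; none is lost because every
     target is reached. *)
  apply/setP => i; apply/idP/idP => [/mem_SatPl[l]|/mP[a [Ta am]]].
    by have [a ->] := qR l => Ta; apply/mem_SatPl; exists a.
  apply/mem_SatPl; case: am => [a0|[j jK am]].
    by exists 0; rewrite q0 -p0 -a0.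
  have [|||l|l|l [_ ql]] := @target_reached V K p m f q
    (fun l => (mem q l).2) m0 mS _ _ _ _ _ j jK.
  - by move=> j' a'; exact: (fP j').2.
  - by rewrite q0 p0.
  - by [].
  - by rewrite memS.
  - by rewrite qS memS /= asboolT.
  by exists l; rewrite ql -am.
exists s; split=> //.
  by move=> i; exists M; split=> //; rewrite card_punishing_machine.
rewrite /nash -/q q_sat => i iS [t [l]].
set r := outcome _ _; have [r_edge r0 rC] := outcomeP (dfwith s t) v0.
rewrite -/r in r_edge r0 rC.
(* Invariant of a deviation by [i]: it stays in [X i], and off [R] the recorded culprit is [i]. *)
suff : X i (r l) /\ (R (r l) \/ val (mem r l).1 = i).
  by move=> [/(deviation_region_safe s'N iS)].
elim: l => [|l [Xr IH]].
  rewrite r0; split; last by left; exists 0.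
  by apply: RX; exists 0.
have [iv|niv] := pselect (ctrl A i (r l)).
  split; first exact: deviation_region_own Xr iv (r_edge l).
  right; rewrite memS /=; case: asboolP => [_|nR]; last by case: IH.
  (* As [i] loses along [p], it belongs to [U], so [insubd] does record it. *)
  by rewrite (ownE _ _ iv) val_insubd UP.
have rS : r l.+1 = mem_nxt (mem r l) (r l).
  rewrite (rC _ _ (ownP (r l))) dfwith_out ?mkseqS ?sE //.
  by apply/eqP => io; apply: niv; rewrite io; exact: ownP.
(* The machine moves here: from [R] it stays in [R], and off [R] it applies [c i], which preserves
   [X i]. So only [i] can leave [R]. *)
rewrite rS memS /=; case: asboolP IH => [[a ->] _|nR [//|mi]].
  have [b fE] := f_range (advance K (p \o m) (mem r l).2 (p a)) a.
  by split; [apply: RX|left]; exists b.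
by rewrite mi; split; [exact: (cP _ _).2|right].
Qed.

(** * Counting visit positions and memory states *)

Lemma VisPos_target (n : nat) (V : Type) (T : 'I_n -> set V) (pi : nat -> V) i :
  i \in SatPl T pi -> exists a, T i (pi a) /\ VisPos T pi a.
Proof.
move=> iS; have /mem_SatPl[l Tl] := iS.
have exP : exists k, `[< T i (pi k) >] by exists l; apply/asboolP.
case: (ex_minnP exP) => a /asboolP Ta aP; exists a; split=> //.
by exists i; split=> //; split=> // k Tk; apply: aP; apply/asboolP.
Qed.

(** Each player has at most one first visit, so [B] lies in the image of a function on the [n]
    players. *)
Lemma card_VisPos (n : nat) (V : Type) (T : 'I_n -> set V) (pi : nat -> V)
    (B : set nat) : (B `<=` VisPos T pi)%classic -> #|` fset_set B | <= n.
Proof.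
move=> BV; have /choice[f fP] (i : 'I_n) : exists m,
    forall k, is_min [set l | T i (pi l)]%classic k -> k = m.
  have [[m [Tm mP]]|H] := pselect (exists m,
      is_min [set l | T i (pi l)]%classic m).
    by exists m => k [Tk kP]; apply/eqP; rewrite eqn_leq kP // mP.
  by exists 0 => k Hk; case: H; exists k.
have finB : finite_set B by apply: sub_finite_set BV (finite_VisPos T pi).
rewrite -[leqRHS]card_ord -(size_codom f); apply: uniq_leq_size => // a.
rewrite in_fset_set // inE => /BV[i [_ /fP ->]]; exact: codom_f.
Qed.

Theorem theorem28 (n : nat) (hn : 1 <= n) (V : Type) (A : arena n V)
    (T : 'I_n -> set V) (v0 : V) (s' : profile A) (hs' : nash T v0 s') :
  (exists s : profile A,
     [/\ finite_memory_profile s,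
         nash T v0 s,
         SatPl T (outcome s v0) = SatPl T (outcome s' v0) &
         forall i, memory_size_at_most (s i)
                     (memory_bound T (outcome s' v0))]) /\
  memory_bound T (outcome s' v0) <= n ^ 2.
Proof.
set p := outcome s' v0; set B := (VisPos T p `\ 0)%classic.
have subB : (B `<=` VisPos T p)%classic by move=> a [].
have finB : finite_set B by apply: sub_finite_set subB (finite_VisPos T p).
rewrite /memory_bound -/B; split; last first.
  by rewrite -mulnn leq_mul // geq_max hn ?leq_subr //; exact: card_VisPos subB.
(* If everyone wins, an arbitrary player keeps the state set nonempty; this is the 1 in the first
   maximum of the bound. *)
pose U := if SatPl T p == [set: 'I_n]%SET then [set Ordinal hn]%SET
          else (~: SatPl T p)%SET.
have cardU : #|U| = maxn 1 (n - #|SatPl T p|).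
  rewrite /U; case: eqP => [->|/eqP nT].
    by rewrite cards1 cardsT card_ord subnn.
  have -> : n - #|SatPl T p| = #|(~: SatPl T p)%SET|.
    by rewrite [RHS]cardsCs finset.setCK card_ord.
  apply/esym/maxn_idPr; rewrite card_gt0 -finset.setCT.
  by rewrite (inj_eq (@finset.setC_inj _)).
have [u uU] : exists u, u \in U.
  by apply/card_gt0P; rewrite cardU leq_maxl.
pose ms := sort leq (fset_set B).
(* The default [1] makes [m 0] positive when [ms] is empty. *)
have [||||||s [sM sN sS]] := @finite_memory_nash n V A T v0 s' U
  (exist _ u uU) (maxn 1 #|` fset_set B|) (nth 1 ms).
- exact: hs'.
- move=> i iS; rewrite /U; case: eqP => [ST|_]; last by rewrite inE.
  by rewrite /p ST inE in iS.
- by rewrite leq_maxl.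
- case E: ms => [//|a ms'] /=.
  have : a \in ms by rewrite E mem_head.
  rewrite mem_sort in_fset_set // inE => -[_].
  by case: (a) => // /(_ erefl).
- move=> j; rewrite leq_max ltnS ltn0 /= -(size_sort leq) -/ms => jK.
  have ms_lt : sorted ltn ms.
    by rewrite ltn_sorted_uniq_leq sort_uniq fset_uniq (sort_sorted leq_total).
  by apply: (sorted_ltn_nth ltn_trans 1 ms_lt); rewrite ?inE // ltnW.
- move=> i /VisPos_target[a [Ta aV]]; exists a; split=> //.
  have [->|a0] := eqVneq a 0; [by left|right].
  have ams : a \in ms.
    by rewrite mem_sort in_fset_set // inE; split=> //; exact/eqP.
  exists (index a ms); last by rewrite nth_index.
  by rewrite leq_max -(size_sort leq) index_mem ams orbT.
exists s; split=> // i; have [M [Mi Mc]] := sM i; first by exists M.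
by exists M; rewrite Mc cardU.
Qed.
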